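(* Let $0<L<\infty$ and $\delta,\lambda>0$. Let $p$ be a power policy, $\ell$ a leakage rate, and let $\pi$ be the stationary battery-charge distribution on $[0,L]$ with atom $\pi_0$ and density $f$ (as defined in the context). Let $\kappa:[0,L]\to(0,\infty)$ be a mismatch factor policy satisfying $$\mathbb{E}_\pi\!\left[\frac1{\kappa(Z)}\right]=\frac{\pi_0}{\kappa(0)}+\int_{0^+}^L\frac{f(z)}{\kappa(z)}\,dz=1 .$$ Then the average distortion satisfies $$\mathbb{E}_{\pi}\!\left[D^{\dagger}\!\left(p(Z),\frac{1}{\kappa(Z)}\right)\right]\ \ge\ D^{\dagger}\!\left(\frac{\delta}{\lambda}\bigl(1-e^{-\lambda L}\bigr),\,1\right).$$
   Context: Rate-distortion function: $R_s$ is a real-valued non-negative function of $D$, with thresholds $0<D_{\max}<\infty$ and $R_s^{\rm th}\in(0,\infty]$, such that [S1] $R_s(D)=0$ for $D\ge D_{\max}$; [S2] on $0<D<D_{\max}$, $R_s$ is twice continuously differentiable with $R_s'(D)<0$ and $R_s''(D)>0$, and $R_s$ is continuous at $D_{\max}$; [S3] $\lim_{D\downarrow 0}R_s'(D)=-\infty$, and $R_s'$ is finite on $(0,D_{\max})$; [S4] $\lim_{D\downarrow 0}R_s(D)=R_s^{\rm th}$, and if $R_s^{\rm th}<\infty$ then $R_s$ is right-continuous at $0$ (with $R_s(0)=R_s^{\rm th}$). Channel coding rate: $R_c:[0,\infty)\to[0,\infty)$ satisfies [C1] $R_c(p)>0$ for $p>0$, $R_c(0)=0$, and $R_c$ is right-continuous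 at $0$; [C2] on $p>0$, $R_c$ is twice continuously differentiable with $R_c'(p)>0$ and $R_c''(p)<0$. Distortion function: for $p\ge 0$ and $\kappa>0$, if $\kappa R_c(p)<R_s^{\rm th}$ then $D(p,\kappa)$ is the unique $D\in(0,D_{\max}]$ with $R_s(D)=\kappa R_c(p)$; if $R_s^{\rm th}<\infty$ and $\kappa R_c(p)\ge R_s^{\rm th}$ then $D(p,\kappa)=0$. Put $D^{\dagger}(p,q):=q\,D(p,1/q)$ for $p\ge0$, $q>0$, so $D^\dagger(p,1/\kappa)=D(p,\kappa)/\kappa$. Battery: energy packets that are i.i.d. exponential with parameter $\lambda$ arrive at the times of a Poisson process of rate $\delta$ into a battery of capacity $L$; at charge $z$ the battery is depleted at rate $p(z)+\ell(z)$, overflow being lost. The policy $p$ and leakage $\ell\ge 0$ are measurable functions on $[0,L]$ with $p(z)>0$ for $z\in(0,L]$, $p(0)=0$, $\ell(0)=0$, $\sup_{0<z\le L}p(z)<\infty$, $\sup_{0<z\le L}\ell(z)<\infty$. The stationary law $\pi$ of the charge $Z$ is a probability measure on $[0,L]$ having an atom $\pi_0\ge 0$ at $0$ and a density $f\ge0$ on $(0,L]$, so $\pi_0+\int_{0^+}^L f(z)\,dz=1$, and it satisfies the balance equation $$f(z)\bigl(p(z)+\ell(z)\bigr)=\delta e^{-\lambda z}\Bigl(\pi_0+\int_{0^+}^z e^{\lambda u}f(u)\,du\Bigr),\qquad 0<z\le L.$$ $\mathbb{E}_\pi[\phi(Z)]=\pi_0\phi(0)+\int_{0^+}^L\phi(z)f(z)\,dz$.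 The function $\kappa$ is measurable. *)

(* Defs.v *)
From HB Require Import structures.
From mathcomp Require Import all_boot all_order all_algebra.
From mathcomp Require Import all_classical all_reals all_analysis.

Set Implicit Arguments.
Unset Strict Implicit.
Unset Printing Implicit Defensive.

Import Order.TTheory GRing.Theory Num.Theory.
Import numFieldNormedType.Exports.
Local Open Scope classical_set_scope.
Local Open Scope ring_scope.

(* Functions whose mathematical domain is an interval are total functions
   [R -> R]; only their values on that interval are constrained or used. *)

(* [A] is meant to be open, so continuity at each point of [A] is the usual
   continuity on [A]. *)
Definition twice_cont_diff (R : realType) (A : set R) (g : R -> R) : Prop :=
  forall x : R, A x ->
    [/\ derivable g x 1, derivable (derive1 g) x 1,
        {for x, continuous (derive1 g)} &
        {for x, continuous (derive1 (derive1 g))}].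

(* When [Rth = +oo] the rate-distortion function lives on [D > 0], and the
   value [Rs 0] is unconstrained and never used. *)
Record rate_distortion (R : realType) (Dmax : R) (Rth : \bar R) (Rs : R -> R)
    : Prop := RateDistortion {
  rd_Dmax_gt0 : 0 < Dmax ;
  rd_Rth_gt0 : (0 < Rth)%E ;
  rd_ge0 : forall D : R, 0 < D -> 0 <= Rs D ;
  rd_eq0 : forall D : R, Dmax <= D -> Rs D = 0 ;
  rd_C2 : twice_cont_diff `]0, Dmax[ Rs ;
  rd_deriv_lt0 : forall D : R, 0 < D < Dmax -> derive1 Rs D < 0 ;
  rd_deriv2_gt0 : forall D : R, 0 < D < Dmax -> 0 < derive1 (derive1 Rs) D ;
  rd_cont_Dmax : {for Dmax, continuous Rs} ;
  rd_deriv_at0 : derive1 Rs D @[D --> 0^'+] --> -oo%R ;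
  rd_lim_at0 : (Rs D)%:E @[D --> 0^'+] --> Rth ;
  rd_at0 : (Rth < +oo)%E ->
    (Rs 0)%:E = Rth /\ Rs D @[D --> 0^'+] --> Rs 0 }.

Record coding_rate (R : realType) (Rc : R -> R) : Prop := CodingRate {
  cr_ge0 : forall x : R, 0 <= x -> 0 <= Rc x ;
  cr_gt0 : forall x : R, 0 < x -> 0 < Rc x ;
  cr_at0 : Rc 0 = 0 ;
  cr_right_cont0 : Rc x @[x --> 0^'+] --> Rc 0 ;
  cr_C2 : twice_cont_diff `]0, +oo[ Rc ;
  cr_deriv_gt0 : forall x : R, 0 < x -> 0 < derive1 Rc x ;
  cr_deriv2_lt0 : forall x : R, 0 < x -> derive1 (derive1 Rc) x < 0 }.

(* For [rate_distortion Dmax Rth Rs], [coding_rate Rc], [0 <= x] and [0 < k],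
   the set in the first branch is a singleton, so [get] returns its element;
   the second branch only occurs for [Rth < +oo]. *)
Definition distortion (R : realType) (Dmax : R) (Rth : \bar R)
    (Rs Rc : R -> R) (x k : R) : R :=
  if ((k * Rc x)%:E < Rth)%E
  then get [set D : R | 0 < D <= Dmax /\ Rs D = k * Rc x]
  else 0.

Definition distortion_dagger (R : realType) (Dmax : R) (Rth : \bar R)
    (Rs Rc : R -> R) (x q : R) : R :=
  q * distortion Dmax Rth Rs Rc x (1 / q).

Record power_policy (R : realType) (L : R) (p : R -> R) : Prop := PowerPolicy {
  pp_measurable : measurable_fun `[0, L] p ;
  pp_gt0 : forall z : R, 0 < z <= L -> 0 < p z ;
  pp_at0 : p 0 = 0 ;
  pp_sup : (ereal_sup ((EFin \o p) @` `]0%R, L]%classic) < +oo)%E }.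

Record leakage_rate (R : realType) (L : R) (l : R -> R) : Prop := LeakageRate {
  lr_measurable : measurable_fun `[0, L] l ;
  lr_ge0 : forall z : R, 0 <= z <= L -> 0 <= l z ;
  lr_at0 : l 0 = 0 ;
  lr_sup : (ereal_sup ((EFin \o l) @` `]0%R, L]%classic) < +oo)%E }.

(* [pi] is the measure on the line equal to [pi0] times the Dirac mass at [0]
   plus [f] times the Lebesgue measure on ]0, L]; it is therefore carried by
   [0, L].  The integrands are nonnegative, so the integrals make sense in the
   extended reals without any integrability proviso. *)
Record stationary_law (R : realType) (L delta lambda : R) (p l : R -> R)
    (pi : probability (measurableTypeR R) R) (pi0 : R) (f : R -> R)
    : Prop := StationaryLaw {
  sl_pi0_ge0 : 0 <= pi0 ;
  sl_measurable : measurable_fun `]0, L] f ;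
  sl_ge0 : forall z : R, 0 < z <= L -> 0 <= f z ;
  sl_law : forall A : set R, measurable A ->
    pi A = (pi0%:E * \d_(0%R : R) A
            + \int[lebesgue_measure]_(z in (A `&` `]0%R, L])%classic)
                (f z)%:E)%E ;
  sl_total : (pi0%:E + \int[lebesgue_measure]_(z in `]0%R, L]) (f z)%:E = 1)%E ;
  sl_balance : forall z : R, 0 < z <= L ->
    ((f z * (p z + l z))%:E
     = (delta * expR (- lambda * z))%:E
       * (pi0%:E + \int[lebesgue_measure]_(u in `]0%R, z])
                     (expR (lambda * u) * f u)%:E))%E }.

Record mismatch_policy (R : realType) (L : R) (kappa : R -> R)
    : Prop := MismatchPolicy {
  mp_measurable : measurable_fun `[0, L] kappa ;
  mp_gt0 : forall z : R, 0 <= z <= L -> 0 < kappa z }.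

(* The expectation of [phi Z] for a [0, L]-valued [Z] with law [pi].  Under
   [stationary_law], for [phi] nonnegative and measurable on [0, L], it equals
   [pi0 * phi 0] plus the Lebesgue integral of [phi z * f z] over ]0, L]. *)
Definition charge_expectation (R : realType) (L : R)
    (pi : probability (measurableTypeR R) R) (phi : R -> R) : \bar R :=
  (\int[pi]_(z in `[0%R, L]) (phi z)%:E)%E.

(* Main.v *)
Require Import Defs.
From mathcomp Require Import all_boot all_order all_algebra.
From mathcomp Require Import all_classical all_reals all_analysis.
From mathcomp Require Import measurable_realfun ring lra.

Import Order.TTheory GRing.Theory Num.Theory.
Import numFieldNormedType.Exports.
Local Open Scope classical_set_scope.
Local Open Scope ring_scope.

(* The function D†(x, q) is jointly convex and nonincreasing in x, so at
   (x0, 1), with x0 = delta / lambda * (1 - exp (- lambda * L)), it lies above an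
   affine function D†(x0, 1) + a (x - x0) + b (q - 1) with a <= 0.  Integrating
   this bound along (p Z, 1 / kappa Z) kills the b-term, and the a-term is
   nonnegative because E[p Z] <= x0.  Indeed, integrating the balance equation
   over ]0, L] and exchanging the integrals shows that E[p Z + l Z] is delta
   times the mean over u = Z of the integral of exp (- lambda * (z - u)) over z
   in [u, L], which is largest at u = 0. *)

(** * Tangent lines of convex and concave functions on a bounded interval *)

Lemma derivable_continuous_at (R : realType) (g : R -> R) (t : R) :
  derivable g t 1 -> {for t, continuous g}.
Proof. by move=> /derivable1_diffP /differentiable_continuous. Qed.

Section tangent_line.
Context (R : realType) (g : R -> R) (a b : R).
Hypothesis cg : {within `[a, b], continuous g}.
Hypothesis dg : forall t, a < t < b -> derivable g t 1.

(** One statement serves both orders of [x] and [x0]: the positive product places [c] on the same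
    side of [x0] as [x]. *)
Lemma mean_value_between (x0 x : R) : a < x0 < b -> a <= x <= b -> x != x0 ->
  exists c : R, [/\ a < c < b, 0 < (c - x0) * (x - x0)
                  & g x - g x0 = derive1 g c * (x - x0)].
Proof.
move=> /andP[ax0 x0b] /andP[ax xb]; rewrite neq_lt => /orP[xx0|x0x].
- have [|t||c] := @MVT R g (derive1 g) x x0.
  + exact: xx0.
  + by rewrite in_itv/= => /andP[xt tx0]; rewrite derive1E; apply/derivableP/dg; lra.
  + by apply: continuous_subspaceW cg; apply: subset_itv; rewrite bnd_simp//; lra.
  + rewrite in_itv/= => /andP[xc cx0] e; exists c; split; [lra|nra|lra].
- have [|t||c] := @MVT R g (derive1 g) x0 x.
  + exact: x0x.
  + by rewrite in_itv/= => /andP[xt tx0]; rewrite derive1E; apply/derivableP/dg; lra.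
  + by apply: continuous_subspaceW cg; apply: subset_itv; rewrite bnd_simp//; lra.
  + rewrite in_itv/= => /andP[xc cx0] e; exists c; split; [lra|nra|lra].
Qed.

Hypothesis ddg : forall t, a < t < b -> derivable (derive1 g) t 1.

(** The chord slope is [derive1 g c] for some [c] on the side of [x]; as [derive1 g] is
    nondecreasing, replacing [c] by [x0] can only lower the product with [x - x0]. The point [x] may
    be an end of the interval, where [g] is merely continuous: this reaches [Dmax] and, for a finite
    threshold, [0]. *)
Lemma convex_above_tangent (x0 x : R) :
  (forall t, a < t < b -> 0 <= derive1 (derive1 g) t) ->
  a < x0 < b -> a <= x <= b -> g x0 + derive1 g x0 * (x - x0) <= g x.
Proof.
move=> ge0 x0ab xab; have [->|xx0] := eqVneq x x0; first by rewrite subrr mulr0 addr0.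
have [c [cab c0 e]] := mean_value_between _ _ x0ab xab xx0.
have mono : {in `]a, b[%R &, {homo derive1 g : x y / x <= y >-> x <= y}}.
  apply: ger0_derive1_le_oo => t.
  - by rewrite in_itv/= => /ddg.
  - by rewrite in_itv/= => /ge0.
  - by rewrite inE/= in_itv/= => /ddg/derivable_continuous_at.
have := mono c x0; have := mono x0 c; rewrite !in_itv/= => /(_ x0ab cab) h1 /(_ cab x0ab) h2.
have [cx0|x0c] := leP c x0; first by have := h2 cx0; nra.
by have := h1 (ltW x0c); nra.
Qed.

Lemma concave_below_tangent (x0 x : R) :
  (forall t, a < t < b -> derive1 (derive1 g) t <= 0) ->
  a < x0 < b -> a <= x <= b -> g x <= g x0 + derive1 g x0 * (x - x0).
Proof.
move=> le0 x0ab xab; have [->|xx0] := eqVneq x x0; first by rewrite subrr mulr0 addr0.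
have [c [cab c0 e]] := mean_value_between _ _ x0ab xab xx0.
have mono : {in `]a, b[%R &, {homo derive1 g : x y /~ x <= y}}.
  apply: ler0_derive1_le_oo => t.
  - by rewrite in_itv/= => /ddg.
  - by rewrite in_itv/= => /le0.
  - by rewrite inE/= in_itv/= => /ddg/derivable_continuous_at.
have := mono c x0; have := mono x0 c; rewrite !in_itv/= => /(_ x0ab cab) h1 /(_ cab x0ab) h2.
have [cx0|x0c] := leP c x0; first by have := h1 cx0; nra.
by have := h2 (ltW x0c); nra.
Qed.

End tangent_line.

Lemma coding_rate_below_tangent (R : realType) (Rc : R -> R) (x0 x : R) :
  coding_rate Rc -> 0 < x0 -> 0 <= x ->
  Rc x <= Rc x0 + derive1 Rc x0 * (x - x0).
Proof.
move=> hRc x00 x_ge0; pose b := x0 + x + 1.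
have {}C2 t : 0 < t -> derivable Rc t 1 /\ derivable (derive1 Rc) t 1.
  by move=> t0; have [] := @cr_C2 _ _ hRc t; rewrite /= ?in_itv/= ?t0.
apply: (@concave_below_tangent R Rc 0 b); rewrite /b.
- apply/continuous_within_itvP; first lra; split.
  + by move=> t; rewrite in_itv/= => /andP[t0 _]; apply/derivable_continuous_at; case: (C2 t t0).
  + exact: cr_right_cont0 hRc.
  + apply/cvg_at_left_filter/derivable_continuous_at.
    by have [] := C2 (x0 + x + 1); first lra.
- by move=> t /andP[/C2[]].
- by move=> t /andP[/C2[]].
- by move=> t /andP[t0 _]; apply/ltW/(cr_deriv2_lt0 hRc).
- lra.
- lra.
Qed.

(** * Supporting plane of the distortion function *)

Section distortion_support.
Context (R : realType) (Dmax : R) (Rth : \bar R) (Rs : R -> R).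
Hypothesis hRs : rate_distortion Dmax Rth Rs.

Lemma rate_distortion_derivable t : 0 < t < Dmax ->
  derivable Rs t 1 /\ derivable (derive1 Rs) t 1.
Proof. by move=> t0; have [] := @rd_C2 _ _ _ _ hRs t; rewrite /= ?in_itv/= ?t0. Qed.

Lemma rate_distortion_continuous a : 0 < a < Dmax ->
  {within `[a, Dmax], continuous Rs}.
Proof.
move=> /andP[a0 aD]; apply/continuous_within_itvP => //; split.
- move=> t; rewrite in_itv/= => /andP[at_ tD]; apply/derivable_continuous_at.
  by have [] := rate_distortion_derivable t; first lra.
- apply/cvg_at_right_filter/derivable_continuous_at.
  by have [] := rate_distortion_derivable a; first lra.
- exact/cvg_at_left_filter/(rd_cont_Dmax hRs).
Qed.

Lemma rate_distortion_above_tangent (D0 D : R) :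
  0 < D0 < Dmax -> 0 < D <= Dmax -> Rs D0 + derive1 Rs D0 * (D - D0) <= Rs D.
Proof.
(* [Rs] may blow up at [0], so the tangent inequality is used on [[a, Dmax]] with a positive [a]
   below both [D0] and [D]. *)
move=> /andP[D00 D0D] /andP[D_gt0 DD]; pose a := Num.min D0 D / 2.
have aD0 : a <= D0 / 2 by rewrite /a ler_pM2r ?invr_gt0// ge_min lexx.
have aD : a <= D / 2 by rewrite /a ler_pM2r ?invr_gt0// ge_min lexx orbT.
have a0 : 0 < a by rewrite /a divr_gt0// lt_min D00.
apply: (@convex_above_tangent R Rs a Dmax); try lra.
- by apply: rate_distortion_continuous; lra.
- by move=> t ?; have [] := rate_distortion_derivable t; first lra.
- by move=> t ?; have [] := rate_distortion_derivable t; first lra.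
- by move=> t ?; apply/ltW/(rd_deriv2_gt0 hRs); lra.
Qed.

(** The tangent inequality at [D = 0], with [Rth] as the value there; it serves the case of zero
    distortion. A finite threshold makes [Rs] continuous on [[0, Dmax]], and an infinite one makes
    the bound trivial. *)
Lemma threshold_above_tangent (D0 : R) :
  0 < D0 < Dmax -> ((Rs D0 - derive1 Rs D0 * D0)%:E <= Rth)%E.
Proof.
move=> D0D; have [Rthoo|] := ltP Rth +oo%E; last by rewrite leye_eq => /eqP ->; exact: leey.
have [<- c0] := rd_at0 hRs Rthoo; rewrite lee_fin.
suff : Rs D0 + derive1 Rs D0 * (0 - D0) <= Rs 0 by lra.
apply: (@convex_above_tangent R Rs 0 Dmax); try lra.
- apply/continuous_within_itvP; [lra|split=> //].
  + move=> t; rewrite in_itv/= => ?; apply/derivable_continuous_at.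
    by have [] := rate_distortion_derivable t.
  + exact/cvg_at_left_filter/(rd_cont_Dmax hRs).
- by move=> t ?; have [] := rate_distortion_derivable t; first lra.
- by move=> t ?; have [] := rate_distortion_derivable t; first lra.
- by move=> t ?; apply/ltW/(rd_deriv2_gt0 hRs); lra.
Qed.

(** Intermediate values between [Dmax], where [Rs] vanishes, and a point near [0], where [Rs]
    exceeds [v] because its limit [Rth] does. This makes [get] in [distortion] return a genuine
    solution. *)
Lemma rate_distortion_onto (v : R) : 0 <= v -> (v%:E < Rth)%E ->
  exists D, 0 < D <= Dmax /\ Rs D = v.
Proof.
move=> v0 vRth; have Dmax0 := rd_Dmax_gt0 hRs.
have RD0 : Rs Dmax = 0 by exact: (rd_eq0 hRs).
have near_v : \forall D \near 0^'+, (v%:E < (Rs D)%:E)%E.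
  have /(_ [set y | (v%:E < y)%E]) := rd_lim_at0 hRs; apply.
  apply: open_nbhs_nbhs; split => //.
  exact: open_ereal_gt_ereal.
have [a [va aD]] : exists a, v < Rs a /\ 0 < a < Dmax.
  near (0:R)^'+ => a; exists a; rewrite -lte_fin; split; first by near: a.
  by apply/andP; split; near: a; [exact: nbhs_right_gt|exact: nbhs_right_lt].
have [|||c] := @IVT R Rs a Dmax v.
- lra.
- exact: rate_distortion_continuous.
- rewrite RD0; apply/andP; split; first by rewrite ge_min v0 orbT.
  by rewrite le_max (ltW va).
- by rewrite in_itv/= => cab <-; exists c; split => //; lra.
Unshelve. all: by end_near. Qed.

Variable Rc : R -> R.
Hypothesis hRc : coding_rate Rc.

Lemma distortionP (x k : R) : 0 <= x -> 0 < k ->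
  let D := distortion Dmax Rth Rs Rc x k in
  [/\ ((k * Rc x)%:E < Rth)%E, 0 < D <= Dmax & Rs D = k * Rc x] \/
  (Rth <= (k * Rc x)%:E)%E /\ D = 0.
Proof.
move=> x0 k0 /=; rewrite /distortion; case: ltP => [lt|le]; last by right.
left; have [D DP] := rate_distortion_onto _ (mulr_ge0 (ltW k0) (cr_ge0 hRc x0)) lt.
by have [] := @getI _ [set D : R | 0 < D <= Dmax /\ Rs D = k * Rc x] D DP.
Qed.

Lemma distortion_ge0 (x k : R) : 0 <= x -> 0 < k ->
  0 <= distortion Dmax Rth Rs Rc x k.
Proof.
by move=> x0 k0; have [[_ /andP[/ltW]]|[_ ->]] := distortionP x k x0 k0.
Qed.

(* The tangent inequalities [Rs D >= Rs D0 + s * (D - D0)] and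
   [Rc x <= Rc x0 + c * (x - x0)], joined by [Rs D = Rc x / q], give the slopes
   [c / s] in [x] and [D0 - Rc x0 / s] in [q]; [a = b = 0] when [D0 = 0]. *)
Lemma distortion_dagger_support (x0 : R) : 0 < x0 ->
  exists a b : R, a <= 0 /\ forall x q : R, 0 <= x -> 0 < q ->
    distortion_dagger Dmax Rth Rs Rc x0 1 + a * (x - x0) + b * (q - 1)
      <= distortion_dagger Dmax Rth Rs Rc x q.
Proof.
move=> x00; set D0 := distortion_dagger _ _ _ _ x0 1.
have D0E : D0 = distortion Dmax Rth Rs Rc x0 1.
  by rewrite /D0 /distortion_dagger mul1r divr1.
have [[_ D0b RsD0]|[_ D00]] := distortionP x0 1 (ltW x00) ltr01; last first.
  exists 0, 0; split=> // x q x_ge0 q0; rewrite D0E D00 !mul0r !addr0.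
  by rewrite mulr_ge0 ?(ltW q0)// distortion_ge0// divr_gt0.
rewrite -D0E in D0b RsD0; rewrite mul1r in RsD0.
have r0 := cr_gt0 hRc x00.
(* [D0 = Dmax] would force [Rc x0 = 0]; strictness gives [Rs] a negative slope at [D0]. *)
have {}D0b : 0 < D0 < Dmax.
  case/andP: D0b => -> D0Dmax; rewrite /= lt_neqAle D0Dmax andbT.
  apply/eqP => D0D; move: r0; rewrite -RsD0 D0D (rd_eq0 hRs)//.
  by rewrite ltxx.
set s := derive1 Rs D0; set c := derive1 Rc x0.
have s0 : s < 0 by exact: (rd_deriv_lt0 hRs).
have c0 : 0 < c by exact: (cr_deriv_gt0 hRc).
exists (c / s), (D0 - Rc x0 / s); split.
  by rewrite mulr_ge0_le0// ?invr_le0; exact: ltW.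
move=> x q x_ge0 q0; rewrite /distortion_dagger; set D := distortion _ _ _ _ _ _.
have q'0 : 0 < 1 / q by rewrite divr_gt0.
(* [key] is the tangent bound for [Rs] at [D], with the rate [Rc x / q] on the right. Multiplied by
   [q] and joined with the tangent bound for [Rc], it gives the goal scaled by [s < 0], hence the
   reversed sign below. *)
suff key : Rc x0 + s * (D - D0) <= 1 / q * Rc x.
  have Rcx := coding_rate_below_tangent _ _ _ _ hRc x00 x_ge0.
  have : q * (Rc x0 + s * (D - D0)) <= Rc x.
    apply: le_trans (_ : q * (1 / q * Rc x) <= _); first by rewrite ler_pM2l.
    by rewrite mul1r mulrA divff ?mul1r// gt_eqF.
  rewrite -/c in Rcx => h.
  rewrite -subr_ge0 -(nmulr_rle0 _ s0).
  have -> : s * (q * D - (D0 + c / s * (x - x0) + (D0 - Rc x0 / s) * (q - 1))) =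
            q * (s * (D - D0)) - c * (x - x0) + Rc x0 * (q - 1).
    by field; rewrite lt_eqF.
  lra.
have [[_ Db <-]|[h D_0]] := distortionP x (1 / q) x_ge0 q'0.
  by rewrite -RsD0; exact: rate_distortion_above_tangent.
(* Zero distortion: [Rc x / q] is at least [Rth], which dominates the tangent at [D = 0]. *)
rewrite -lee_fin; apply: le_trans h; rewrite /D D_0 -RsD0 sub0r mulrN.
exact: threshold_above_tangent.
Qed.

End distortion_support.

(** * Integration against a density, and an exponential integral *)

Section density.
Local Open Scope ereal_scope.
Context d (T : measurableType d) (R : realType).
Variables (mu nu : {measure set T -> \bar R}) (D : set T) (f : T -> R).
Hypothesis mD : measurable D.
Hypothesis mf : measurable_fun D f.
Hypothesis f0 : forall x, D x -> (0 <= f x)%R.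
Hypothesis nuE : forall A, measurable A -> A `<=` D ->
  nu A = \int[mu]_(x in A) (f x)%:E.

Import HBNNSimple.

(** [nuE] is the case of indicators; linearity extends it to simple functions, and monotone
    convergence along an increasing simple approximation to every nonnegative measurable [g]. *)
Lemma ge0_integral_density (g : T -> \bar R) :
  measurable_fun D g -> (forall x, D x -> 0 <= g x) ->
  \int[nu]_(x in D) g x = \int[mu]_(x in D) (g x * (f x)%:E).
Proof.
move=> mg g0; pose h := nnsfun_approx mD mg.
have mfE : measurable_fun D (EFin \o f) by exact/measurable_EFinP.
have mh n : measurable_fun D (EFin \o h n) by exact/measurable_EFinP/measurable_funTS.
have h_cvg x : D x -> (EFin \o h ^~ x) n @[n --> \oo] --> g x.
  by move=> Dx; exact: cvg_nnsfun_approx.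
have -> : \int[nu]_(x in D) g x = limn (fun n => \int[nu]_(x in D) (h n x)%:E).
  rewrite -monotone_convergence//.
  - by apply: eq_integral => x /[!inE] Dx; apply/esym/cvg_lim => //; exact: h_cvg.
  - by move=> n x _; rewrite lee_fin.
  - by move=> x Dx a b ab; rewrite lee_fin; exact/lefP/nd_nnsfun_approx.
have -> : \int[mu]_(x in D) (g x * (f x)%:E) =
          limn (fun n => \int[mu]_(x in D) ((h n x)%:E * (f x)%:E)).
  rewrite -monotone_convergence//.
  - apply: eq_integral => x /[!inE] Dx; apply/esym/cvg_lim => //.
    by apply: cvgeZr => //; exact: h_cvg.
  - by move=> n; apply: emeasurable_funM; [exact: mh|exact: mfE].
  - by move=> n x Dx; rewrite mule_ge0// lee_fin// f0.
  - move=> x Dx a b ab; rewrite lee_wpmul2r// lee_fin ?f0//.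
    exact/lefP/nd_nnsfun_approx.
(* Both sides are limits over the same simple functions, so they are compared for each [n], as
   finite sums over the values of [h n]. *)
congr (limn _); apply/funext => n.
have mr r : measurable (h n @^-1` [set r]) by exact: measurable_sfunP.
under eq_integral do rewrite fimfunE -fsumEFin//.
under [RHS]eq_integral.
  move=> x _; rewrite fimfunE -fsumEFin// ge0_mule_fsuml; last first.
    by move=> y; rewrite EFinM; exact: nnfun_muleindic_ge0.
  over.
rewrite ge0_integral_fsum//; last 2 first.
- by move=> r; apply/measurable_EFinP/measurable_funM => //; exact: measurable_indic.
- by move=> r x _; rewrite EFinM; exact: nnfun_muleindic_ge0.
rewrite ge0_integral_fsum//; last 2 first.
- move=> r; apply: emeasurable_funM => //.
  by apply/measurable_EFinP/measurable_funM => //; exact: measurable_indic.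
- move=> r x Dx; apply: mule_ge0; last by rewrite lee_fin f0.
  by rewrite EFinM; exact: nnfun_muleindic_ge0.
apply: eq_fsbigr => r rh.
rewrite integralZl_indic_nnsfun// integral_indic//.
rewrite nuE; [|exact: measurableI|exact: subIsetr].
rewrite setIC integral_mkcondr -ge0_integralZl//.
- apply: eq_integral => x xD; rewrite EFinM -muleA; congr (_ * _).
  by rewrite muleC epatch_indic.
- by apply/measurable_restrict => //; apply: measurable_funS mfE => //; exact: subIsetl.
- by move=> x Dx; rewrite patchE; case: ifP => // _; rewrite lee_fin f0.
- by move: rh; rewrite inE => -[t _ <-]; rewrite lee_fin.
Qed.

End density.

Lemma integral_expRN (R : realType) (lambda a b : R) : 0 < lambda -> a <= b ->
  (\int[lebesgue_measure]_(z in `[a, b]) (expR (- lambda * z))%:E =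
   ((expR (- lambda * a) - expR (- lambda * b)) / lambda)%:E)%E.
Proof.
move=> l0; rewrite le_eqVlt => /predU1P[->|ab].
  by rewrite set_itv1 integral_set1 subrr mul0r.
have cexp : continuous (fun z : R => expR (- lambda * z)).
  by move=> z; apply: derivable_continuous_at; exact: ex_derive.
have cF : continuous (fun z : R => - expR (- lambda * z) / lambda).
  by move=> z; apply: derivable_continuous_at; exact: ex_derive.
rewrite (@continuous_FTC2 _ _ (fun z => - expR (- lambda * z) / lambda))//.
- by rewrite -EFinB; congr EFin; lra.
- exact: continuous_subspaceT.
- split.
  + by move=> z _; exact: ex_derive.
  + exact/cvg_at_right_filter/cF.
  + exact/cvg_at_left_filter/cF.
- move=> z _.
  have -> : (fun z => - expR (- lambda * z) / lambda) =
      (- lambda^-1) \*o (fun z => expR (- lambda * z)).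
    by apply/funext => y /=; rewrite !mulNr mulrC.
  rewrite derive1Ml//.
  rewrite [X in _ * X](@derive1_comp _ (fun z => - lambda * z) expR)//.
  rewrite derive1E derive_val derive1Ml// derive1_id mulr1.
  by field; rewrite gt_eqF.
Qed.

(** * Mean power under the stationary law *)

Section battery.
Context (R : realType) (L delta lambda : R) (p l : R -> R)
  (pi : probability (measurableTypeR R) R) (pi0 : R) (f : R -> R).
Hypotheses (hL : 0 < L) (hdelta : 0 < delta) (hlambda : 0 < lambda).
Hypotheses (hp : power_policy L p) (hl : leakage_rate L l).
Hypothesis hpi : stationary_law L delta lambda p l pi pi0 f.

Local Notation mu := (@lebesgue_measure R).
Local Notation D := (`]0, L]%classic : set R).
Local Notation C := ((1 - expR (- lambda * L)) / lambda).

(** As [g] vanishes at [0], the atom contributes nothing, and on []0, L]] the law has density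
    [f]. *)
Lemma stationary_integral (g : R -> \bar R) :
  measurable_fun `[0, L] g -> (forall z, 0 <= z <= L -> (0 <= g z)%E) -> g 0 = 0%E ->
  (\int[pi]_(z in `[0%R, L]) g z = \int[mu]_(z in `]0%R, L]) (g z * (f z)%:E))%E.
Proof.
move=> mg g0 g00.
have subD : D `<=` `[0, L] by apply: subset_itv; rewrite bnd_simp.
have -> : (\int[pi]_(z in `[0%R, L]) g z = \int[pi]_(z in D) g z)%E.
  rewrite integral_mkcond [RHS]integral_mkcond; apply: eq_integral => z _.
  rewrite !patchE; have [zD|zD] := boolP (z \in D).
    by rewrite mem_set//; exact/subD/set_mem.
  case: ifPn => //; rewrite inE/= in_itv/= => /andP[z0 zL].
  suff -> : z = 0 by [].
  apply/eqP; rewrite eq_le z0 andbT leNgt; apply: contraNN zD => z_gt0.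
  by rewrite inE/= in_itv/= z_gt0.
apply: ge0_integral_density => //.
- exact: sl_measurable hpi.
- by move=> z /=; rewrite in_itv/=; exact: (sl_ge0 hpi).
- move=> A mA AD; apply: etrans (sl_law hpi mA) _.
  rewrite diracE memNset; last by move=> /AD/=; rewrite in_itv/= ltxx.
  by rewrite mule0 add0e; congr integral; exact/setIidPl.
- exact: measurable_funS mg.
- move=> z /=; rewrite in_itv/= => /andP[z0 zL]; apply: g0; lra.
Qed.

(** With [w = (z, u)], this is [exp (- lambda * (z - u)) * f u] on the triangle [0 < u <= z <= L],
    extended by zero to the plane so that Tonelli applies to integrals over the whole line. *)
Let kernel (w : R * R) : R :=
  \1_D w.1 * \1_[set w : R * R | w.2 <= w.1] w *
  (expR (- lambda * w.1) * (expR (lambda * w.2) * (f \_ D) w.2)).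

Let fD_ge0 u : 0 <= (f \_ D) u.
Proof.
rewrite patchE; case: ifP => //; rewrite inE/= in_itv/= => uD.
exact: (sl_ge0 hpi).
Qed.

Let kernel_ge0 w : 0 <= kernel w.
Proof. by rewrite /kernel !mulr_ge0// ?expR_ge0. Qed.

Let kernelE_ge0 w : (0 <= (EFin \o kernel) w)%E.
Proof. by rewrite lee_fin. Qed.

Let mfD : measurable_fun setT (f \_ D).
Proof. by apply/(measurable_restrictT _ _).1 => //; exact: sl_measurable hpi. Qed.

Let mexp c : measurable_fun setT (fun z : R => expR (c * z)).
Proof. by apply: measurableT_comp => //; exact: mulrl_measurable. Qed.

Let measurable_kernel : measurable_fun setT (EFin \o kernel).
Proof.
apply/measurable_EFinP; apply: measurable_funM; first apply: measurable_funM.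
- have mD : measurable_fun setT (\1_D : R -> R) by exact: measurable_indic.
  exact: (measurableT_comp mD measurable_fst).
- apply: measurable_indic; rewrite -[X in measurable X]setTI.
  exact: (measurable_fun_ler measurable_snd measurable_fst measurableT (Y := [set true])).
- apply: measurable_funM; first exact: (measurableT_comp (mexp _) measurable_fst).
  apply: measurable_funM; first exact: (measurableT_comp (mexp _) measurable_snd).
  exact: (measurableT_comp mfD measurable_snd).
Qed.

(** Integrating out [u] recovers, up to the factor [delta], the non-atomic term of the balance
    equation. *)
Let integral_kernel1 z : D z ->
  (\int[mu]_u (kernel (z, u))%:E =
   (expR (- lambda * z))%:E * \int[mu]_(u in `]0%R, z]) (expR (lambda * u) * f u)%:E)%E.
Proof.
move=> Dz; rewrite [in RHS]integral_mkcond -ge0_integralZl//.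
- apply: eq_integral => u _; rewrite /kernel/= !patchE !indicE mem_set// mul1r.
  move: Dz; rewrite /= in_itv/= => /andP[z0 zL].
  have [uz|uz] := boolP (u \in `]0, z]%classic).
    have /andP[u0 {}uz] : 0 < u <= z by move: uz; rewrite inE/= in_itv.
    by rewrite !mem_set ?mul1r -?EFinM//= in_itv/= u0 (le_trans uz zL).
  rewrite mule0; case: ifPn => [|_]; last by rewrite !mulr0.
  rewrite inE/= in_itv/= => /andP[u0 uL]; rewrite memNset ?mul0r//= => {}uL.
  by move: uz; rewrite notin_setE/= in_itv/= u0 uL.
- apply/(measurable_restrictT _ _).1 => //; apply/measurable_EFinP.
  apply: measurable_funM; first exact: measurable_funTS (mexp _).
  apply: measurable_funS (sl_measurable hpi) => //.
  by move: Dz; rewrite /= in_itv/= => /andP[_ zL]; apply: subset_itvl; rewrite bnd_simp.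
- move=> u _; rewrite patchE; case: ifPn => //; rewrite inE/= in_itv/= => /andP[u0 uz].
  move: Dz; rewrite /= in_itv/= => /andP[_ zL].
  by rewrite lee_fin mulr_ge0 ?expR_ge0// (sl_ge0 hpi)// u0 (le_trans uz zL).
Qed.

(** For [u] in []0, L]] the integral is [f u * (1 - exp (- lambda * (L - u))) / lambda], whose
    factor of [f u] is at most its value [C] at [u = 0]; for other [u] both sides vanish. *)
Let integral_kernel2_le u :
  (\int[mu]_z (kernel (z, u))%:E <= C%:E * ((f \_ D) u)%:E)%E.
Proof.
have [uD|uD] := boolP (u \in D); last first.
  rewrite integral0_eq ?patchE ?(negbTE uD) ?mule0// => z _.
  by rewrite /kernel patchE (negbTE uD) !mulr0.
have /andP[u0 uL] : 0 < u <= L by move: uD; rewrite inE/= in_itv.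
have F0 := fD_ge0 u; set F := (f \_ D) u in F0 *.
have -> : (\int[mu]_z (kernel (z, u))%:E = (expR (lambda * u) * F)%:E *
    \int[mu]_(z in `[u, L]) (expR (- lambda * z))%:E)%E.
  rewrite [in RHS]integral_mkcond -ge0_integralZl//.
  - apply: eq_integral => z _; rewrite /kernel/= -/F [in RHS]patchE !indicE.
    have [zD|zD] := boolP (z \in `[u, L]%classic).
      have /andP[uz zL] : u <= z <= L by move: zD; rewrite inE/= in_itv.
      rewrite !mem_set/= ?in_itv/= ?zL ?(lt_le_trans u0 uz)// !mul1r -EFinM.
      by congr EFin; ring.
    rewrite mule0; congr EFin; apply/eqP; rewrite mulf_eq0; apply/orP; left.
    have [zD'|] := boolP (z \in D); last by rewrite mul0r.
    rewrite memNset ?mulr0//= => uz; move: zD; rewrite notin_setE/= in_itv/= uz.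
    by move: zD'; rewrite inE/= in_itv/= => /andP[_ ->].
  - apply/(measurable_restrictT _ _).1 => //; apply/measurable_EFinP.
    exact: measurable_funTS (mexp _).
  - by move=> z _; rewrite patchE; case: ifP => // _; rewrite lee_fin expR_ge0.
  - by rewrite lee_fin mulr_ge0 ?expR_ge0.
rewrite integral_expRN// -!EFinM lee_fin.
have : expR (lambda * u) * expR (- lambda * u) = 1.
  by rewrite -expRD mulNr subrr expR0.
have : 1 <= expR (lambda * u) by rewrite -expR0 ler_expR mulr_ge0// ltW.
have := expR_gt0 (- lambda * L); set x := expR (- lambda * L); set e := expR (lambda * u).
set e' := expR _ => x0 e1 ee'.
(* It remains to see that [e * (e' - x) = 1 - e * x <= 1 - x], from [e * e' = 1], [e >= 1] and
   [x > 0]. *)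
rewrite mulrA [leRHS]mulrAC ler_pM2r ?invr_gt0//.
have : x <= e * x by rewrite ler_peMl// ltW.
have -> : e * F * (e' - x) = F * (1 - e * x) by rewrite -ee'; ring.
by move=> ?; rewrite [leRHS]mulrC; apply: ler_wpM2l => //; lra.
Qed.

Lemma integral_kernel_le :
  (\int[mu]_z \int[mu]_u (kernel (z, u))%:E <= C%:E * \int[mu]_(u in D) (f u)%:E)%E.
Proof.
have C0 : 0 <= C.
  rewrite divr_ge0 ?(ltW hlambda)// subr_ge0 -expR0 ler_expR mulNr oppr_le0.
  by rewrite mulr_ge0 ?ltW.
have -> : (\int[mu]_(u in D) (f u)%:E = \int[mu]_u ((f \_ D) u)%:E)%E.
  by rewrite integral_mkcond; apply: eq_integral => u _; rewrite !patchE; case: ifP.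
have -> : (\int[mu]_z \int[mu]_u (kernel (z, u))%:E = \int[mu]_u \int[mu]_z (kernel (z, u))%:E)%E.
  have H := @fubini_tonelli _ _ _ _ R mu mu (EFin \o kernel) measurable_kernel kernelE_ge0.
  exact: H.
rewrite -ge0_integralZl//.
- apply: ge0_le_integral => //.
  + by move=> u _; apply: integral_ge0 => z _; rewrite lee_fin.
  + have H := @measurable_fun_fubini_tonelli_G _ _ _ _ R mu (EFin \o kernel)
      measurable_kernel kernelE_ge0.
    exact: H.
  + by apply: measurable_funeM; exact/measurable_EFinP.
- exact/measurable_EFinP.
- by move=> u _; rewrite lee_fin.
Qed.

(** Since [l >= 0], [p * f] is at most [(p + l) * f], which the balance equation evaluates. The atom
    then contributes [delta * C * pi0] and the kernel at most [delta * C * (1 - pi0)], so the sum is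
    at most [delta * C]. *)
Lemma stationary_power_le :
  (\int[pi]_(z in `[0%R, L]) (p z)%:E <=
   (delta / lambda * (1 - expR (- lambda * L)))%:E)%E.
Proof.
have p0 z : 0 <= z <= L -> 0 <= p z.
  move=> /andP[]; rewrite le_eqVlt => /predU1P[<-|z0] zL; first by rewrite (pp_at0 hp).
  by rewrite ltW// (pp_gt0 hp)// z0.
have mW := @measurable_fun_fubini_tonelli_F _ _ _ _ R mu (EFin \o kernel)
  measurable_kernel kernelE_ge0.
rewrite (stationary_integral (EFin \o p))/=; last 3 first.
- by apply/measurable_EFinP; exact: pp_measurable hp.
- by move=> z zL; rewrite lee_fin p0.
- by rewrite (pp_at0 hp).
have pD z : D z -> 0 < z <= L by rewrite /= in_itv.
have W0 z : (0 <= \int[mu]_u (kernel (z, u))%:E)%E.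
  by apply: integral_ge0 => u _; rewrite lee_fin.
have mWD : measurable_fun D (fun z => \int[mu]_u (kernel (z, u))%:E)%E.
  exact: measurable_funTS mW.
have me : measurable_fun D (fun z => (pi0 * expR (- lambda * z))%:E).
  by apply/measurable_EFinP/measurable_funM => //; exact: measurable_funTS (mexp _).
have e0 z : (0 <= (pi0 * expR (- lambda * z))%:E)%E.
  by rewrite lee_fin mulr_ge0 ?expR_ge0// (sl_pi0_ge0 hpi).
apply: (@le_trans _ _ (\int[mu]_(z in D)
  (delta%:E * ((pi0 * expR (- lambda * z))%:E + \int[mu]_u (kernel (z, u))%:E)))%E).
  apply: ge0_le_integral => //.
  - move=> z /pD zD; rewrite -EFinM lee_fin mulr_ge0 ?(sl_ge0 hpi)//.
    by rewrite ltW// (pp_gt0 hp).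
  - apply: emeasurable_funM; last by apply/measurable_EFinP; exact: sl_measurable hpi.
    apply/measurable_EFinP; apply: measurable_funS (pp_measurable hp) => //.
    by apply: subset_itv; rewrite bnd_simp.
  - by apply: measurable_funeM; exact: emeasurable_funD.
  - move=> z Dz; rewrite integral_kernel1//; have zD := pD z Dz.
    rewrite mulrC EFinM -muleDr//.
    rewrite muleA -EFinM -(sl_balance hpi)// lee_fin [leRHS]mulrC.
    apply: ler_wpM2r; first exact: (sl_ge0 hpi).
    by rewrite lerDl (lr_ge0 hl)//; case/andP: zD => /ltW -> ->.
rewrite ge0_integralZl//; last 3 first.
- exact: emeasurable_funD.
- by move=> z _; exact: adde_ge0.
- by rewrite lee_fin ltW.
rewrite ge0_integralD//.
have -> : (\int[mu]_(z in D) (pi0 * expR (- lambda * z))%:E = (pi0 * C)%:E)%E.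
  under eq_integral do rewrite EFinM.
  rewrite ge0_integralZl//; last first.
  - by rewrite lee_fin (sl_pi0_ge0 hpi).
  - by apply/measurable_EFinP; exact: measurable_funTS (mexp _).
  - rewrite integral_itv_obnd_cbnd//; last first.
      by apply/measurable_EFinP; exact: measurable_funTS (mexp _).
    by rewrite integral_expRN ?(ltW hL)// mulr0 expR0 -EFinM.
have WC : (\int[mu]_(z in D) \int[mu]_u (kernel (z, u))%:E <= (C * (1 - pi0))%:E)%E.
  apply: (@le_trans _ _ (\int[mu]_z \int[mu]_u (kernel (z, u))%:E)%E).
    by apply: ge0_subset_integral.
  apply: le_trans integral_kernel_le _; rewrite EFinM.
  suff -> : (\int[mu]_(u in D) (f u)%:E = (1 - pi0)%:E)%E by [].
  by rewrite EFinB -(sl_total hpi) addeC addeA -EFinN -EFinD addNr add0e.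
apply: (@le_trans _ _ (delta%:E * ((pi0 * C)%:E + (C * (1 - pi0))%:E))%E).
  by rewrite lee_pmul2l// ?lte_fin// leeD2l.
rewrite -EFinD -EFinM lee_fin le_eqVlt; apply/orP; left; apply/eqP.
by field; rewrite gt_eqF.
Qed.

End battery.

(* No measurability: the integral of a nonnegative function is a supremum over
   simple functions, so it is monotone on arbitrary functions. *)
Lemma le_integral_ge0r d (T : measurableType d) (R : realType)
    (mu : {measure set T -> \bar R}) (D : set T) (g h : T -> \bar R) :
  (forall x, D x -> (g x <= h x)%E) -> (forall x, D x -> (0 <= h x)%E) ->
  (\int[mu]_(x in D) g x <= \int[mu]_(x in D) h x)%E.
Proof.
move=> gh h0; rewrite integralE.
apply: (@le_trans _ _ (\int[mu]_(x in D) (g^\+)%E x)%E).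
  by apply: geeDl; rewrite oppe_le0; exact: integral_ge0.
rewrite !ge0_integralE//; apply: le_ereal_sup => _ [k kg <-]; exists k => // x.
apply: le_trans (kg x) _; rewrite !patchE; case: ifPn => //; rewrite inE => Dx.
by rewrite funepos.unlock ge_max gh ?h0.
Qed.

(** * The lower bound on the average distortion *)

Lemma stationary_mass (R : realType) (L delta lambda : R) (p l : R -> R)
    (pi : probability (measurableTypeR R) R) (pi0 : R) (f : R -> R) :
  0 <= L -> stationary_law L delta lambda p l pi pi0 f -> pi `[0, L]%classic = 1%E.
Proof.
move=> L0 hpi; apply: etrans (sl_law hpi _) _; first exact: measurable_itv.
rewrite diracE mem_set; last by rewrite /= in_itv/= lexx.
rewrite mule1 setIidr; first exact: (sl_total hpi).
by apply: subset_itv; rewrite bnd_simp.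
Qed.

Theorem mainTheorem2 (R : realType)
  (Dmax : R) (Rth : \bar R) (Rs Rc : R -> R)
  (hRs : rate_distortion Dmax Rth Rs) (hRc : coding_rate Rc)
  (L delta lambda : R) (hL : 0 < L) (hdelta : 0 < delta) (hlambda : 0 < lambda)
  (p l : R -> R) (hp : power_policy L p) (hl : leakage_rate L l)
  (pi : probability (measurableTypeR R) R) (pi0 : R) (f : R -> R)
  (hpi : stationary_law L delta lambda p l pi pi0 f)
  (kappa : R -> R) (hkappa : mismatch_policy L kappa)
  (hmean : charge_expectation L pi (fun z => 1 / kappa z) = 1%E) :
  ((distortion_dagger Dmax Rth Rs Rc
      (delta / lambda * (1 - expR (- lambda * L))) 1)%:E
   <= charge_expectation L pi
        (fun z => distortion_dagger Dmax Rth Rs Rc (p z) (1 / kappa z)))%E.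
Proof.
set x0 := delta / lambda * _.
have x00 : 0 < x0.
  rewrite /x0 mulr_gt0 ?divr_gt0// subr_gt0 -expR0 ltr_expR mulNr oppr_lt0.
  exact: mulr_gt0.
have [a [b [a0 support]]] := distortion_dagger_support _ _ _ _ hRs _ hRc x0 x00.
set D0 := distortion_dagger _ _ _ _ x0 1 in support *.
have p0 z : `[0, L]%classic z -> 0 <= p z.
  rewrite /= in_itv/= => /andP[]; rewrite le_eqVlt => /predU1P[<-|z0] zL.
    by rewrite (pp_at0 hp).
  by rewrite ltW// (pp_gt0 hp)// z0.
have kappa0 z : `[0, L]%classic z -> 0 < 1 / kappa z.
  by rewrite /= in_itv/= => zL; rewrite divr_gt0// (mp_gt0 hkappa).
have mass := stationary_mass _ _ _ _ _ _ _ _ _ (ltW hL) hpi.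
have mp : measurable_fun `[0, L] p := pp_measurable hp.
have Ep := stationary_power_le _ _ _ _ _ _ _ _ _ hL hdelta hlambda hp hl hpi.
(* The bound on the mean power also makes [p] integrable, so the affine bound can be integrated term
   by term whatever the signs of its coefficients. *)
have ip : pi.-integrable `[0, L] (EFin \o p).
  apply/integrableP; split; first exact/measurable_EFinP.
  under eq_integral => z /[!inE] zL do rewrite gee0_abs ?lee_fin ?p0//.
  by rewrite (le_lt_trans Ep)// ltry.
have ik : pi.-integrable `[0, L] (fun z => (1 / kappa z)%:E).
  apply/integrableP; split.
    (* On [[0, L]] the inverse of [kappa] is the real power with exponent [-1], a measurable
       function of [kappa]. *)
    apply: (eq_measurable_fun (fun z => (kappa z `^ (-1))%:E)).
      move=> z /[!inE] zL; rewrite powR_inv1 ?div1r//.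
      by move: zL; rewrite /= in_itv/= => /(mp_gt0 hkappa)/ltW.
    apply/measurable_EFinP; apply: (measurableT_comp (@measurable_powR R (-1))).
    exact: mp_measurable hkappa.
  under eq_integral => z /[!inE] zL do rewrite gee0_abs ?lee_fin ?(ltW (kappa0 z zL))//.
  by rewrite [ltLHS]hmean ltry.
have ic c : pi.-integrable `[0, L] (fun=> c%:E).
  by apply: finite_measure_integrable_cst.
(* The supporting plane at [(x0, 1)] along the charge, with its constant terms gathered. *)
pose affine z : \bar R := ((D0 - a * x0 - b)%:E + a%:E * (p z)%:E + b%:E * (1 / kappa z)%:E)%E.
have Eaffine : (\int[pi]_(z in `[0%R, L]) affine z =
    (D0 - a * x0 - b)%:E + a%:E * \int[pi]_(z in `[0%R, L]) (p z)%:E + b%:E)%E.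
  rewrite integralD//; last exact: integrableZl.
    rewrite integralD//; last exact: integrableZl.
    rewrite !integralZl//.
    rewrite [X in (b%:E * X)%E]hmean mule1 integral_cst//.
    by rewrite [X in (_ * X)%E](mass : _ = 1%E) mule1.
  by apply: integrableD => //; exact: integrableZl.
(* The terms [- b] and [b] cancel, leaving the mean [D0 + a * (E[p] - x0)]; both factors of the
   product are nonpositive, so it is at least [D0]. *)
apply: (@le_trans _ _ (\int[pi]_(z in `[0%R, L]) affine z)%E).
  rewrite Eaffine.
  have pfin : (\int[pi]_(z in `[0%R, L]) (p z)%:E)%E \is a fin_num.
    exact: (integrable_fin_num _ ip).
  rewrite -(fineK pfin) -EFinM -!EFinD lee_fin.
  have : fine (\int[pi]_(z in `[0%R, L]) (p z)%:E)%E <= x0 by rewrite -lee_fin fineK.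
  by nra.
apply: le_integral_ge0r => z zL.
  rewrite /affine -!EFinM -!EFinD lee_fin.
  have := support (p z) (1 / kappa z) (p0 z zL) (kappa0 z zL); lra.
rewrite lee_fin mulr_ge0 ?(ltW (kappa0 z zL))//.
apply: distortion_ge0 => //; first exact: p0.
by rewrite divr_gt0// kappa0.
Qed.
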